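(* Let $G$ be an unbreakable 3-cyclic digraph. Then the following are equivalent: (i) $G$ is diwheel-free; (ii) $G$ admits a 3-ring $(A_1,A_2,A_3)$ such that each of the graphs $G^-[A_1\cup A_2]$, $G^-[A_2\cup A_3]$, $G^-[A_3\cup A_1]$ is a tree; (iii) $G$ can be built starting from a tricycle by repeatedly adding a new vertex with exactly one out-neighbour and exactly one in-neighbour (among the vertices already present at the time it is added); (iv) $G$ has exactly $2|G|-3$ edges.
   Context: A digraph is a finite directed graph without loops or parallel edges (directed cycles of length two are permitted); $uv$ denotes an edge from $u$ to $v$, and $|G|=|V(G)|$. A digraph is 3-cyclic if all its directed cycles have length three. For a digraph $G$ (without directed cycles of length two), $G^-$ is the undirected graph with vertex set $V(G)$ in which distinct $u,v$ are adjacent if and only if $uv\in E(G)$ or $vu\in E(G)$. A non-null digraph is strongly connected if for every two vertices $u,v$ there is a directed path from $u$ to $v$; it is weakly 2-connected if $G^-$ is 2-connected (at least three vertices, connected, no cutvertex). $G$ is unbreakable if it is strongly connected and weakly 2-connected. $G^-[X]$ denotes the subgraph induced on $X$. A tricycle is a directed cycle of length three. A 3-ring of $G$ is an ordered partition $(A_1,A_2,A_3)$ of $V(G)$ such that for every edge $uv$ of $G$ there exists $i\in\{1,2,3\}$ with $u\in A_i$ and $v\in A_{i+1}$ (subscripts modulo 3). A diwheel is a digraph obtained as follows: take an undirected graph consisting of a cycle $C$ of even length (at least four) and an extra vertex $v$ (the hub) adjacent to every vertex of $C$, and direct its edges so that for every edge of $C$, that edge together with $v$ forms a tricycle. $G$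 is diwheel-free if no subdigraph of $G$ is a diwheel. *)

(* Defs.v *)
From mathcomp Require Import all_boot.

Set Implicit Arguments.
Unset Strict Implicit.
Unset Printing Implicit Defensive.

(* A (di)graph is given by its adjacency relation [e : rel T] on a finite type
   [T], which is its whole vertex set: [e u v] is the edge uv of a digraph, and
   undirected graphs are irreflexive symmetric relations. Loops are excluded by
   the hypothesis [irreflexive e] wherever it matters. *)

Definition induced (T : finType) (e : rel T) (X : {set T}) :
  rel {x | x \in X} := fun x y => e (val x) (val y).
Arguments induced {T} e X.

Definition underlying (T : finType) (e : rel T) : rel T :=
  fun u v => (u != v) && (e u v || e v u).

(* [connect e u v] is the existence of a directed path from u to v, so for a
   symmetric [e] this is connectedness of a non-null undirected graph. *)
Definition strongly_connected (T : finType) (e : rel T) : Prop :=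
  0 < #|T| /\ forall u v : T, connect e u v.

Definition cutvertex (T : finType) (r : rel T) (v : T) : Prop :=
  exists x y : {x | x \in [set~ v]},
    connect r (val x) (val y) /\ ~~ connect (induced r [set~ v]) x y.

Definition two_connected (T : finType) (r : rel T) : Prop :=
  [/\ 3 <= #|T|, strongly_connected r & forall v : T, ~ cutvertex r v].

Definition is_tree (T : finType) (r : rel T) : Prop :=
  strongly_connected r /\
  forall c : seq T, 3 <= size c -> uniq c -> ~~ cycle r c.

Definition three_cyclic (T : finType) (e : rel T) : Prop :=
  forall c : seq T, c <> [::] -> uniq c -> cycle e c -> size c = 3.

Definition unbreakable (T : finType) (e : rel T) : Prop :=
  strongly_connected e /\ two_connected (underlying e).

Definition is_tricycle (T : finType) (e : rel T) : Prop :=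
  exists c : seq T,
    [/\ uniq c, size c = 3, forall x, x \in c
      & forall x y, e x y = (y == next c x)].

Definition three_ring (T : finType) (e : rel T) (A : 'I_3 -> {set T}) : Prop :=
  (forall x : T, exists! i, x \in A i) /\
  (forall u v : T, e u v -> exists i, u \in A i /\ v \in A (ordS i)).

Definition cycle_adj (T : finType) (c : seq T) : rel T :=
  fun x y => (x \in c) && (y == next c x) || (y \in c) && (x == next c y).

Definition wheel_adj (T : finType) (v : T) (c : seq T) : rel T :=
  fun x y => [|| cycle_adj c x y, (x == v) && (y \in c)
               | (y == v) && (x \in c)].

Definition orientation_of (T : finType) (r e : rel T) : Prop :=
  (forall x y : T, r x y = e x y || e y x) /\
  (forall x y : T, ~~ (e x y && e y x)).

Definition is_diwheel (T : finType) (e : rel T) : Prop :=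
  exists (v : T) (c : seq T),
    [/\ uniq (v :: c) /\ forall x, x \in v :: c,
        4 <= size c /\ ~~ odd (size c),
        orientation_of (wheel_adj v c) e
      & forall x y, cycle_adj c x y -> is_tricycle (induced e [set x; y; v])].

(* A subdigraph has vertex set [X] and as edges the pairs of [F] inside [X]. *)
Definition diwheel_free (T : finType) (e : rel T) : Prop :=
  forall (X : {set T}) (F : rel T),
    subrel F e -> ~ is_diwheel (induced F X).

(* [buildable e X]: the subdigraph induced on [X] can be built from a tricycle.
   A new vertex brings only edges between itself and the vertices already
   present, so every stage is the subdigraph induced on the vertices so far. *)
Inductive buildable (T : finType) (e : rel T) : {set T} -> Prop :=
| Buildable_tricycle (X : {set T}) :
    is_tricycle (induced e X) -> buildable e X
| Buildable_add (X : {set T}) (v : T) :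
    buildable e X -> v \notin X ->
    #|[set u in X | e v u]| = 1 ->
    #|[set u in X | e u v]| = 1 ->
    buildable e (v |: X).

Definition num_edges (T : finType) (e : rel T) : nat :=
  #|[set p : T * T | e p.1 p.2]|.

(* Main.v *)
Require Import Defs.
From mathcomp Require Import all_boot zify.

Set Implicit Arguments.
Unset Strict Implicit.
Unset Printing Implicit Defensive.

(* Closed walks have length divisible by 3, so there is a colouring by Z/3
   whose classes form a 3-ring; write N(v) for the neighbours of v, and
   "away i" for the vertices not coloured i.
   - If v -> x, y -> v and x reaches y in G - v, then xy is an edge. Hence any
     two neighbours of v lie in one component of G^-[away (col v)] (v is not a
     cutvertex), and so every G^-[away i] is connected.
   - A path of G^-[away (col v)] with both ends in N(v) stays in N(v), since
     otherwise there is a directed cycle of length at least four through v.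
     So a cycle of G^-[away i] is the rim of a diwheel, whose hub is the third
     vertex of a tricycle through one of its edges. Also, G^-[N(v)] is
     connected; hence a vertex set X in which no vertex is isolated can always
     be enlarged, if proper, by a vertex with an in- and an out-neighbour in X.
   - Growing X from a tricycle in this way adds at least two edges at each
     step, and exactly two at all steps iff there are 2|G| - 3 edges; if the
     three graphs G^-[away i] are trees, each step adds exactly two edges.
   - Every vertex of a diwheel has degree at least three in it, so its last
     vertex cannot have been added with only two edges. *)

(** * Paths and connectedness inside a vertex set *)

Section Connectivity.
Variables (T : finType) (r : rel T).
Implicit Types (S X : {set T}) (x y : T) (p : seq T).

(** Stays on the type [T], unlike [induced], so that different sets [S] can be compared. *)
Definition restr (S : {set T}) : rel T :=
  [rel x y | [&& x \in S, y \in S & r x y]].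

Lemma restr_sym S : symmetric r -> symmetric (restr S).
Proof. by move=> r_sym x y; rewrite /restr /= r_sym andbCA. Qed.

Lemma connect_restrS (S S' : {set T}) x y :
  S \subset S' -> connect (restr S) x y -> connect (restr S') x y.
Proof.
move/subsetP=> sSS'; apply: connect_sub => {}x {}y /and3P[/sSS' Sx /sSS' Sy rxy].
by apply: connect1; rewrite /restr /= Sx Sy.
Qed.

Lemma connect_restr_last (S : {set T}) x y :
  x \in S -> connect (restr S) x y -> y \in S.
Proof.
move=> Sx /connectP[p]; elim: p x Sx => [|z p IHp] x Sx /= => [_ -> //|].
by case/andP=> /and3P[_ Sz _] /IHp; apply.
Qed.

Lemma connect_invariant (P : T -> Prop) x y :
    P x -> (forall z z', P z -> r z z' -> P z') ->
  connect r x y -> P y.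
Proof.
move=> + PS /connectP[p + ->]; elim: p x => //= z p IHp x Px /andP[/(PS x z Px)].
exact: IHp.
Qed.

Lemma connect_uniq_path x y :
  connect r x y -> exists p, [/\ path r x p, last x p = y & uniq (x :: p)].
Proof.
by case/connectP=> p /shortenP[p' rp' Up' _] ->; exists p'.
Qed.

Lemma path_restrP S x p :
  x \in S -> path (restr S) x p -> path r x p /\ {subset p <= S}.
Proof.
elim: p x => //= y p IHp x Sx /andP[/and3P[_ Sy rxy] /(IHp _ Sy)[rp sp]].
by rewrite rxy; split=> // z; rewrite inE => /predU1P[->|/sp].
Qed.

Lemma sub_path_restr (S : {set T}) x p :
  x \in S -> {subset p <= S} -> path r x p -> path (restr S) x p.
Proof.
elim: p x => //= y p IHp x Sx sp /andP[rxy rp].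
have Sy: y \in S by rewrite sp ?mem_head.
by rewrite {1}/restr /= Sx Sy rxy IHp // => z pz; rewrite sp // inE pz orbT.
Qed.

Lemma connect_crossing (X : {set T}) x y :
    connect r x y -> x \in X -> y \notin X ->
  exists p q : T, [/\ r p q, p \in X & q \notin X].
Proof.
case/connectP=> p + ->; elim: p x => [x _ /= -> //|z p IHp x /= /andP[rxz rp] Xx].
have [Xz|nXz] := boolP (z \in X); first exact: IHp rp Xz.
by exists x, z.
Qed.

Lemma map_val_lift X (c : seq T) :
  {subset c <= X} -> exists c' : seq {x | x \in X}, map val c' = c.
Proof.
elim: c => [|x c IHc] sX; first by exists [::].
have [|c' <-] := IHc; first by move=> y cy; rewrite sX // inE cy orbT.
by have Xx := sX x (mem_head _ _); exists (Sub x Xx :: c'); rewrite /= ?SubK.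
Qed.

End Connectivity.

Lemma connect_inducedE (T : finType) (r : rel T) (S : {set T})
    (x y : {x | x \in S}) :
  connect (induced r S) x y = connect (restr r S) (val x) (val y).
Proof.
apply/idP/idP.
  apply: (connect_invariant (P := fun z => connect (restr r S) (val x) (val z))).
    exact: connect0.
  move=> z z' xz rzz'; apply: connect_trans xz _; apply: connect1.
  by rewrite /restr /= (valP z) (valP z').
case/connectP=> p rp Dy; have [_ /map_val_lift[p' Dp]] := path_restrP (valP x) rp.
apply/connectP; exists p'; last by apply: val_inj; rewrite Dy -Dp last_map.
move: rp; rewrite -Dp (map_path (e' := induced r S) (b := pred0)) ?has_pred0 //.
by move=> u v _; rewrite /restr /= (valP u) (valP v).
Qed.

(** * Cyclic arithmetic of the three colours *)

Lemma ord3_cases (i j : 'I_3) : [|| j == i, j == ordS i | j == ordS (ordS i)].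
Proof. by case: i j => [[|[|[|?]]] ?] [[|[|[|?]]] ?]. Qed.

Lemma ord3_avoid (i j : 'I_3) :
  (j == i) || (j == ordS i) = (j != ordS (ordS i)).
Proof. by case: i j => [[|[|[|?]]] ?] [[|[|[|?]]] ?]. Qed.

Lemma ordS3 (i : 'I_3) : ordS (ordS (ordS i)) = i.
Proof. by apply: val_inj; case: i => [[|[|[|?]]] ?]. Qed.

Lemma ordS_neq (i : 'I_3) : (ordS i == i) = false.
Proof. by case: i => [[|[|[|?]]] ?]. Qed.

Lemma ordSS_neq (i : 'I_3) : (ordS (ordS i) == i) = false.
Proof. by case: i => [[|[|[|?]]] ?]. Qed.

Lemma not_uniq_split (A : eqType) (s : seq A) :
  ~~ uniq s -> exists x s1 s2 s3, s = s1 ++ x :: s2 ++ x :: s3.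
Proof.
elim: s => //= x s IHs; rewrite negb_and negbK.
have [/splitPr[s1 s2] _ | _ /= /IHs[y [s1 [s2 [s3 ->]]]]] := boolP (x \in s).
  by exists x, [::], s1, s2.
by exists y, (x :: s1), s2, s3.
Qed.

(** * Closed walks and detours in strongly connected 3-cyclic digraphs *)

Section ThreeCyclic.
Variables (T : finType) (e : rel T).
Implicit Types (S X : {set T}) (v w x y z : T).
Hypotheses (e_irrefl : irreflexive e) (e_3cyclic : three_cyclic e).
Hypothesis e_conn : forall x y, connect e x y.

Local Notation u := (underlying e).

Lemma underlyingE x y : u x y = e x y || e y x.
Proof. by rewrite /underlying; case: eqP => // ->; rewrite e_irrefl. Qed.

Lemma underlying_sym : symmetric u.
Proof. by move=> x y; rewrite !underlyingE orbC. Qed.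

Lemma edge_neq x y : e x y -> x != y.
Proof. by apply: contraTneq => ->; rewrite e_irrefl. Qed.

Lemma edge_asym x y : e x y -> e y x = false.
Proof.
move=> exy; apply/negP=> eyx; have := e_3cyclic (c := [:: x; y]).
by rewrite /= inE edge_neq ?exy ?eyx // => /(_ _ isT isT) H; have := H ltac:(by []).
Qed.

(** A simple directed path back from [y] to [x] closes with the edge into a directed cycle,
    necessarily of length three. *)
Lemma edge_triangle x y : e x y -> exists2 z, e y z & e z x.
Proof.
move=> exy; have [p [ep Dx Up]] := connect_uniq_path (e_conn y x).
have := e_3cyclic (c := y :: p); rewrite Up => /(_ _ isT).
rewrite /= rcons_path ep Dx exy => /(_ ltac:(by []) isT).
case: p ep Dx {Up} => [|z [|t [|s p]]] //= /and3P[eyz ezt _] <- _.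
by exists z.
Qed.

(** Induction on the length: at a repeated vertex a closed walk splits into two shorter ones. *)
Lemma closed_walk_dvd3 c : cycle e c -> 3 %| size c.
Proof.
have [n] := ubnP (size c); elim: n c => // n IHn c /ltnSE-le_c_n ec.
have [Uc | /not_uniq_split[x [c1 [c2 [c3 Dc]]]]] := boolP (uniq c).
  by case: c ec Uc {le_c_n} => // x c ec Uc; rewrite (e_3cyclic _ Uc ec).
have ec': cycle e (x :: c2 ++ x :: c3 ++ c1).
  by rewrite -(rot_cycle (size c1)) Dc rot_size_cat /= -catA in ec.
have Dn: size c = size (x :: c2) + size (x :: c3 ++ c1).
  rewrite Dc !size_cat /= !size_cat /= ; lia.
move: ec'; rewrite /= rcons_cat cat_path /= => /and3P[e2 ex e31].
rewrite Dn dvdn_add // IHn //=.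
- by apply: leq_trans le_c_n; rewrite Dn /=; lia.
- by rewrite rcons_path e2.
by apply: leq_trans le_c_n; rewrite Dn /=; lia.
Qed.

Lemma closed_path_dvd3 x p : path e x p -> last x p = x -> 3 %| size p.
Proof.
case: p => // y p ep Dx; apply: closed_walk_dvd3.
by rewrite (cycle_path x) -[last x _]/(last x (y :: p)) Dx.
Qed.

(** The colour is the length modulo 3 of some walk from a root [r]. For an edge, the walks chosen
    for its two ends are compared by closing both with the same walk from [y] to [r]. *)
Lemma colouring_exists :
  0 < #|T| -> exists col : T -> 'I_3, forall x y, e x y -> col y = ordS (col x).
Proof.
case/card_gt0P=> r _.
have walk x : exists n, [exists t : n.-tuple T, path e r t && (last r t == x)].
  have /connectP[p ep ->] := e_conn r x; exists (size p); apply/existsP.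
  by exists (in_tuple p); rewrite ep eqxx.
pose d x := xchoose (walk x).
have dP x : exists p, [/\ path e r p, last r p = x & size p = d x].
  have /existsP[p /andP[ep /eqP Dx]] := xchooseP (walk x).
  by exists p; rewrite size_tuple.
exists (fun x => inord (d x %% 3)) => x y exy.
have [p [ep Dp sp]] := dP x; have [q [eq Dq sq]] := dP y.
have /connectP[s es Ds] := e_conn y r.
have h1: 3 %| size (q ++ s).
  by apply: (@closed_path_dvd3 r); rewrite ?last_cat ?cat_path ?eq Dq.
have h2: 3 %| size (p ++ y :: s).
  apply: (@closed_path_dvd3 r); rewrite ?last_cat ?cat_path ?ep Dp //=.
  by rewrite exy.
apply: val_inj; rewrite /= !inordK ?ltn_pmod //.
move: h1 h2; rewrite !size_cat /= sp sq; lia.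
Qed.

(** If the edge points from [y] to [x], the other two sides of a tricycle on it lead from [x] to
    [y]; the last hypothesis keeps the third vertex in [S]. *)
Lemma edge_connect S x y :
    x \in S -> y \in S -> u x y -> (forall z, e x z -> e z y -> z \in S) ->
  connect (restr e S) x y.
Proof.
move=> Sx Sy; rewrite underlyingE => /orP[exy|eyx] Sz.
  by apply: connect1; rewrite /restr /= Sx Sy.
have [z exz ezy] := edge_triangle eyx; have {}Sz := Sz z exz ezy.
by apply: (@connect_trans _ _ z); apply: connect1; rewrite /restr /= ?Sx ?Sy Sz.
Qed.

(** A simple path from [x] to [y] closes through [v] into a directed cycle; length three leaves room
    for one edge only. *)
Lemma detour_edge v x y :
  e v x -> e y v -> connect (restr e [set~ v]) x y -> e x y.
Proof.
move=> evx eyv /connect_uniq_path[p [ep Dy Up]].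
have nvx: x \in [set~ v] by rewrite !inE eq_sym edge_neq.
have [{}ep sp] := path_restrP nvx ep.
have nvp: v \notin x :: p.
  by rewrite inE negb_or edge_neq //; apply/negP=> /sp; rewrite !inE eqxx.
have := @e_3cyclic (v :: x :: p) ltac:(by []).
rewrite cons_uniq nvp Up /= evx rcons_path ep Dy eyv => /(_ isT isT).
by case: p ep Dy {Up sp nvp} => [|z [|? ?]] //= /andP[exz _] <-.
Qed.

(** Here [v], [x], a simple path in [S] and [y] would form a directed cycle of length at least
    four. *)
Lemma no_detour S v x s t y :
    [/\ v \notin S, x \notin S & y \notin S] -> s \in S ->
    e v x -> e x s -> connect (restr e S) s t -> e t y -> e y v ->
  False.
Proof.
case=> nSv nSx nSy Ss evx exs /connect_uniq_path[p [ep Dt Up]] ety eyv.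
have [{}ep sp] := path_restrP Ss ep.
have sp': {subset s :: p <= S} by move=> z /predU1P[->|/sp].
have notin z : z \notin S -> z \notin s :: p by apply: contraNN => /sp'.
have nxy: x != y by apply/eqP=> Dx; rewrite -Dx (edge_asym evx) in eyv.
have Uc: uniq (v :: x :: rcons (s :: p) y).
  move: (s :: p) Up notin => q Uq notin.
  rewrite 2!cons_uniq rcons_uniq Uq andbT in_cons !mem_rcons !(in_cons y).
  rewrite !negb_or nxy (edge_neq evx) (eq_sym v y) (edge_neq eyv).
  by rewrite !notin.
have := @e_3cyclic (v :: x :: rcons (s :: p) y) ltac:(by []) Uc.
rewrite /= evx exs rcons_path last_rcons rcons_path ep Dt ety eyv size_rcons.
by move/(_ isT).
Qed.

(** * Colour classes and the neighbourhood of a vertex *)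

Variable col : T -> 'I_3.
Hypothesis col_e : forall x y, e x y -> col y = ordS (col x).

Definition away i := [set x | col x != i].

Lemma mem_away i x : (x \in away i) = (col x != i).
Proof. by rewrite inE. Qed.

Lemma col_u x y : u x y -> col x != col y.
Proof.
by rewrite underlyingE => /orP[] /col_e->; rewrite ?ordS_neq // eq_sym ordS_neq.
Qed.

Lemma away_u x y : u x y -> y \in away (col x).
Proof. by move/col_u; rewrite mem_away eq_sym. Qed.

Lemma connect_away_sym i x y :
  connect (restr u (away i)) x y = connect (restr u (away i)) y x.
Proof. exact/sym_connect_sym/restr_sym/underlying_sym. Qed.

Lemma connect_away1 i x y :
  x \in away i -> y \in away i -> u x y -> connect (restr u (away i)) x y.
Proof. by move=> ix iy uxy; apply: connect1; rewrite /restr /= ix iy. Qed.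

Lemma edge_underlying x y : e x y -> u x y.
Proof. by rewrite underlyingE => ->. Qed.

Lemma edge_underlyingC x y : e x y -> u y x.
Proof. by rewrite underlyingE orbC => ->. Qed.

(** Tricycles through [v] replace [q] by an out-neighbour [x] of [v] that reaches it, and [z] by an
    in-neighbour [y] that it reaches; by [detour_edge] there is an edge from [x] to [y], which joins
    the two inside [away (col v)]. *)
Lemma connect_nbr v q z :
    u v q -> u v z -> connect (restr e [set~ v]) q z ->
  connect (restr u (away (col v))) q z.
Proof.
move=> uvq uvz qz.
have nv t : u v t -> t \in [set~ v].
  by rewrite !inE; apply: contraTN => /eqP->; rewrite underlyingE e_irrefl.
have D1 s t : u v s -> u v t -> e s t ->
    connect (restr e [set~ v]) s t /\ connect (restr u (away (col v))) s t.
  move=> uvs uvt est; split; last first.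
    exact: connect_away1 (away_u uvs) (away_u uvt) (edge_underlying est).
  by rewrite connect1 // /restr /= !nv.
have [x evx [xq Axq]] : exists2 x, e v x &
    connect (restr e [set~ v]) x q /\ connect (restr u (away (col v))) x q.
  have:= uvq; rewrite underlyingE => /orP[evq | eqv].
    by exists q; rewrite ?connect0.
  have [x evx exq] := edge_triangle eqv; exists x => //.
  by apply: D1 => //; apply: edge_underlying.
have [y eyv [zy Azy]] : exists2 y, e y v &
    connect (restr e [set~ v]) z y /\ connect (restr u (away (col v))) z y.
  have:= uvz; rewrite underlyingE => /orP[evz | ezv].
    have [y ezy eyv] := edge_triangle evz; exists y => //.
    by apply: D1 => //; apply: edge_underlyingC.
  by exists z; rewrite ?connect0.
have exy: e x y by apply: detour_edge evx eyv (connect_trans xq (connect_trans qz zy)).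
rewrite connect_away_sym in Axq; rewrite connect_away_sym in Azy.
apply: connect_trans Axq (connect_trans _ Azy).
apply: connect_away1 (edge_underlying exy); apply: away_u.
  exact: edge_underlying.
exact: edge_underlyingC.
Qed.

Lemma nbr_connected v p q :
    u v p -> u v q -> connect (restr u [set~ v]) p q ->
  connect (restr u (away (col v))) p q.
Proof.
move=> uvp uvq pq; pose A := connect (restr u (away (col v))).
suff [z [uvz Apz zq]] : exists z, [/\ u v z, A p z & connect (restr e [set~ v]) z q].
  exact: connect_trans Apz (connect_nbr uvz uvq zq).
(* Along the path, [z] is the last recorded neighbour of [v]. If both ends of the next edge are
   neighbours of [v], the far end becomes [z]; otherwise no tricycle on that edge contains [v], and
   [edge_connect] extends the directed walk. *)
apply: (connect_invariant (P := fun q => exists z,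
  [/\ u v z, A p z & connect (restr e [set~ v]) z q])) pq.
  by exists p; rewrite uvp /A !connect0.
move=> s t [z [uvz Apz zs]] /and3P[vs vt ust].
have [/andP[uvs uvt]|Nuv] := boolP (u v s && u v t).
  exists t; rewrite uvt connect0; split=> //.
  apply: connect_trans Apz (connect_trans (connect_nbr uvz uvs zs) _).
  exact: connect_away1 (away_u uvs) (away_u uvt) ust.
exists z; split=> //; apply: connect_trans zs _; apply: edge_connect => // w esw ewt.
rewrite !inE; apply: contraNneq Nuv => <-.
by rewrite edge_underlyingC ?edge_underlying.
Qed.

Lemma not_u_col v w : col w = col v -> ~~ u v w.
Proof. by move=> cw; apply/negP=> /col_u; rewrite cw eqxx. Qed.

(* The vertices s and t lie in one strong component of G - (v |: N(v)); in each
   case a directed cycle enters it from v through x or y and returns to v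
   through the other, hence has length at least four. *)
Lemma hub_segment v x y s t (A := [set z in away (col v) | ~~ u v z]) :
    x != y -> u v x -> u v y -> s \in A -> u x s -> u t y ->
  connect (restr u A) s t -> False.
Proof.
(* Unlike [A], [S] also contains vertices coloured like [v]. The third vertex of a tricycle on an
   edge of [A] is one of them, so paths in [A] become directed paths in [S]. *)
pose S := [set z | (z != v) && ~~ u v z].
move=> nxy uvx uvy As uxs uty st.
have sAS: A \subset S.
  apply/subsetP=> z; rewrite !inE => /andP[cz ->]; rewrite andbT.
  by apply: contraNneq cz => ->.
have At: t \in A by apply: connect_restr_last st.
have uS z z' : z \in A -> u z z' -> col z' = col v -> z' \in S.
  rewrite !inE => /andP[_ nvz] uzz' /not_u_col->; rewrite andbT.
  by apply: contraNneq nvz => <-; rewrite underlying_sym.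
have eS z z' : connect (restr u A) z z' -> connect (restr e S) z z'.
  apply: connect_sub => {}z {}z' /and3P[Az Az' uzz'].
  apply: edge_connect => [||//|w ezw ewz']; try exact: (subsetP sAS).
  apply: (uS z) => //; first exact: edge_underlying.
  move: Az Az'; rewrite !inE (col_e ewz') (col_e ezw) => /andP[cz _] /andP[cz' _].
  have:= ord3_cases (col z) (col v).
  by rewrite !(eq_sym (col v)) (negPf cz) (negPf cz') orbF => /eqP.
have {}At' : col t != col v by move: At; rewrite !inE => /andP[].
have {}As' : col s != col v by move: As; rewrite !inE => /andP[].
have ts: connect (restr u A) t s.
  by rewrite sym_connect_sym //; apply/restr_sym/underlying_sym.
have nS z : u v z -> z \notin S by rewrite !inE negb_and negbK orbC => ->.
have nSv : v \notin S by rewrite !inE eqxx.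
(* Colours fix the direction of edges between N(v) and [A]: they leave out-neighbours of [v] and
   enter in-neighbours. *)
have out z z' : e v z -> u z z' -> col z' != col v -> e z z' /\ col z' = ordS (col z).
  rewrite underlyingE => evz /orP[ezz' _|ez'z]; first by rewrite (col_e ezz').
  by move: (col_e ez'z); rewrite (col_e evz) => /ordS_inj->; rewrite eqxx.
have inn z z' : e z v -> u z z' -> col z' != col v -> e z' z /\ col z = ordS (col z').
  rewrite underlyingE => ezv /orP[/col_e cz'|ez'z _]; last by rewrite (col_e ez'z).
  by rewrite cz' (col_e ezv) eqxx.
have Ss := subsetP sAS s As; have St := subsetP sAS t At.
have /orP[evx|exv] : e v x || e x v by rewrite -underlyingE.
  have [exs cs] := out x s evx uxs As'.
  have /orP[evy|eyv] : e v y || e y v by rewrite -underlyingE.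
    have [eyt ct] := out y t evy ltac:(by rewrite underlying_sym) At'.
    (* For two out-neighbours, [w] leads from [s] back to [x] and [z] from [x] to [v], so a cycle
       runs from [v] through [y], [t], [x] and [z]. *)
    have [w esw ewx] := edge_triangle exs.
    have [z exz ezv] := edge_triangle evx.
    have Sw: w \in S.
      apply: (uS s) => //; first exact: edge_underlying.
      by rewrite (col_e esw) cs (col_e evx) ordS3.
    have tx: connect (restr e (x |: S)) t x.
      apply: connect_trans (connect_restrS (subsetUr _ _) (eS _ _ ts)) _.
      by apply: (@connect_trans _ _ w); apply: connect1;
        rewrite /restr /= !in_setU1 ?eqxx ?Ss Sw ?orbT.
    apply: (@no_detour (x |: S) v y t x z) => //; last by rewrite in_setU1 St orbT.
    split; rewrite in_setU1 negb_or.
    - by rewrite nSv andbT edge_neq.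
    - by rewrite nS // eq_sym nxy.
    by rewrite nS ?edge_underlyingC // eq_sym edge_neq.
  have [ety ct] := inn y t eyv ltac:(by rewrite underlying_sym) At'.
  by apply: (@no_detour S v x s t y) => //; [split=> //; exact: nS | exact: eS].
have [esx cs] := inn x s exv uxs As'.
have /orP[evy|eyv] : e v y || e y v by rewrite -underlyingE.
  have [eyt ct] := out y t evy ltac:(by rewrite underlying_sym) At'.
  by apply: (@no_detour S v y t s x) => //; [split=> //; exact: nS | exact: eS].
have [ety ct] := inn y t eyv ltac:(by rewrite underlying_sym) At'.
have [w exw ews] := edge_triangle esx.
have [z evz ezx] := edge_triangle exv.
have Sw: w \in S.
  apply: (uS s) => //; first exact: edge_underlyingC.
  by rewrite (col_e exw) (col_e exv).
have xt: connect (restr e (x |: S)) x t.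
  apply: connect_trans (connect_restrS (subsetUr _ _) (eS _ _ st)).
  by apply: (@connect_trans _ _ w); apply: connect1;
    rewrite /restr /= !in_setU1 ?eqxx ?Ss Sw ?orbT.
apply: (@no_detour (x |: S) v z x t y) => //; last by rewrite in_setU1 eqxx.
split; rewrite in_setU1 negb_or.
- by rewrite nSv andbT eq_sym edge_neq.
- by rewrite nS ?edge_underlying // edge_neq.
by rewrite nS // eq_sym nxy.
Qed.

(** Induction on the length. If the vertex after [x] is outside N(v), it starts a segment of
    non-neighbours up to the next neighbour of [v], excluded by [hub_segment]; otherwise [x] is
    dropped. *)
Lemma hub_path v x (p : seq T) :
    path (restr u (away (col v))) x p -> uniq (x :: p) ->
    u v x -> u v (last x p) ->
  all (u v) p.
Proof.
have [n] := ubnP (size p); elim: n p x => // n IHn p x /ltnSE-le_p_n.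
case: p le_p_n => // y p le_p_n ap Uxp uvx uvl.
have [uvy | nuvy] := boolP (u v y).
  rewrite /= uvy; apply: IHn uvy uvl => //; first by case/andP: ap.
  by case/andP: Uxp.
have hp: has (u v) p.
  apply/hasP; exists (last y p) => //.
  by move: uvl; case: p {ap Uxp le_p_n} => [|z p] /=; rewrite ?(negPf nuvy) ?mem_last.
case/split_find: hp ap Uxp {le_p_n uvl} => z p1 p2 uvz nup1.
rewrite -cats1 -catA /= cat_path /= => /and4P[axy ap1 alz _] Uxp.
case: (@hub_segment v x z y (last y p1)) => //.
- move: Uxp; rewrite !inE mem_cat inE !negb_or => /andP[/and4P[] //].
- by rewrite inE nuvy andbT; case/and3P: axy.
- by case/and3P: axy.
- by case/and3P: alz.
have Ay: y \in away (col v) by case/and3P: axy.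
have [up1 sp1] := path_restrP Ay ap1.
apply/connectP; exists p1 => //; apply: sub_path_restr up1.
  by rewrite inE Ay.
by move=> t p1t; rewrite inE sp1 //; apply: contraNN nup1 => uvt; apply/hasP; exists t.
Qed.

(** * Absence of cutvertices: connected colour pairs and growth *)

Hypothesis u_nocut : forall v, ~ cutvertex u v.

Lemma connect_underlying x y : connect u x y.
Proof.
apply: connect_sub (e_conn x y) => s t est.
by apply: connect1; apply: edge_underlying.
Qed.

Lemma connect_delete v x y :
  x != v -> y != v -> connect (restr u [set~ v]) x y.
Proof.
move=> xv yv; have Vx: x \in [set~ v] by rewrite !inE.
have Vy: y \in [set~ v] by rewrite !inE.
apply/negPn/negP=> nxy; apply: (@u_nocut v).
exists (Sub x Vx), (Sub y Vy); rewrite connect_inducedE !SubK; split=> //.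
exact: connect_underlying.
Qed.

Lemma away_connected i x y :
  x \in away i -> y \in away i -> connect (restr u (away i)) x y.
Proof.
move=> ix; pose A := connect (restr u (away i)).
(* The path in G^- may meet vertices coloured [i]; there only some neighbour is claimed to be
   reached, and [nbr_connected] carries the claim to the next vertex. *)
pose P z := if col z == i then exists2 q, u z q & A x q else A x z.
have: P y.
  apply: (connect_invariant (P := P)) (connect_underlying x y).
    by move: ix; rewrite mem_away /P => /negPf->; apply: connect0.
  move=> z z' + uzz'; have := col_u uzz'; rewrite /P.
  have [Dz|nz] := eqVneq (col z) i => /negPf.
    rewrite Dz eq_sym => -> [q uzq Axq]; apply: connect_trans Axq _.
    rewrite /A -Dz; apply: nbr_connected => //.
    by apply: connect_delete; apply: contraTneq isT => Dq;
       [have:= col_u uzq | have:= col_u uzz']; rewrite Dq eqxx.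
  move=> _ Axz; have [Dz'|nz'] := eqVneq (col z') i.
    by exists z => //; rewrite underlying_sym.
  by apply: connect_trans Axz _; apply: connect_away1; rewrite ?mem_away.
by rewrite /P mem_away => Py /negPf nyi; rewrite nyi in Py.
Qed.

(** Adjacent neighbours of [v] differ in colour, so one is an out-neighbour and one an in-neighbour:
    every triangle of G^- is a tricycle. *)
Lemma triangle_in_out v p q :
    u v p -> u v q -> u p q ->
  exists a b, [/\ a \in [set v; q], b \in [set v; q], e a p & e p b].
Proof.
move=> + + upq; have := col_u upq; move: upq.
rewrite !underlyingE => upq cpq /orP[evp|epv] /orP[evq|eqv].
- by rewrite (col_e evp) (col_e evq) eqxx in cpq.
- exists v, q; rewrite evp !inE !eqxx orbT; split=> //; case/orP: upq => // /col_e.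
  by rewrite (col_e evp) (col_e eqv) => /eqP; rewrite ordS_neq.
- exists q, v; rewrite epv !inE !eqxx orbT; split=> //; case/orP: upq => // /col_e.
  by rewrite (col_e evq) (col_e epv) => /eqP; rewrite ordS_neq.
by move: (col_e epv) cpq; rewrite (col_e eqv) => /ordS_inj->; rewrite eqxx.
Qed.

Lemma growth_step X x0 :
    x0 \in X -> (forall x, x \in X -> exists2 y, y \in X & u x y) -> X != setT ->
  exists v a b, [/\ v \notin X, a \in X, b \in X, e a v & e v b].
Proof.
move=> Xx0 Xnbr nXT.
have [y nXy] : exists y, y \notin X.
  by apply/existsP; apply: contraR nXT; rewrite negb_exists => /forallP-XT;
     apply/eqP/setP=> y; rewrite inE; apply/negPn/XT.
have [x [z [uxz Xx nXz]]] := connect_crossing (connect_underlying x0 y) Xx0 nXy.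
have [q Xq uxq] := Xnbr x Xx.
have [p [ap Dp Up]] :=
  connect_uniq_path (away_connected (away_u uxq) (away_u uxz)).
(* By [hub_path] the path stays in N(x), so some edge [s t] inside N(x) leaves [X]; its triangle
   with [x] has [x] and [s] in [X]. *)
have nbrp: {subset p <= [set t | u x t]}.
  by move=> t pt; rewrite inE; move: t pt; apply/allP/(hub_path ap Up uxq); rewrite Dp.
have [up _] := path_restrP (away_u uxq) ap.
have qz: connect (restr u [set t | u x t]) q z.
  apply/connectP; exists p => //; apply: sub_path_restr up => //.
  by rewrite inE.
have [s [t [/and3P[]]]] := connect_crossing qz Xq nXz.
rewrite !inE => uxs uxt ust Xs nXt.
have [a [b [+ + eat etb]]] := triangle_in_out uxt uxs ltac:(by rewrite underlying_sym).
rewrite !inE => Da Db; exists t, a, b; split=> //.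
  by case/orP: Da => /eqP->.
by case/orP: Db => /eqP->.
Qed.

End ThreeCyclic.

(** * Tricycles as induced subdigraphs *)

Lemma is_tricycle_induced (T : finType) (e : rel T) (X : {set T}) a b c :
    (forall x y, e x y -> e y x = false) ->
    e a b -> e b c -> e c a -> X = [set a; b; c] ->
  is_tricycle (induced e X).
Proof.
move=> e_asym eab ebc eca ->.
have e_irr x : e x x = false by apply/negP=> exx; move: (exx); rewrite e_asym.
have neq x y : e x y -> (x == y) = false.
  by move=> exy; apply/eqP=> Dx; rewrite Dx e_irr in exy.
have [ab bc ca] := And3 (neq a b eab) (neq b c ebc) (neq c a eca).
have [ba cb ac] : [/\ (b == a) = false, (c == b) = false & (a == c) = false].
  by split; rewrite eq_sym.
have Uabc: uniq [:: a; b; c] by rewrite /= !inE ab bc ac.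
have [|s Ds] := @map_val_lift _ [set a; b; c] [:: a; b; c].
  by move=> x; rewrite !inE orbA.
have Us: uniq s by rewrite -(map_inj_uniq val_inj) Ds.
exists s; split=> //; first by rewrite -(size_map val) Ds.
  by move=> x; rewrite -(mem_map val_inj) Ds; have:= valP x; rewrite !inE orbA.
move=> x y; rewrite -(inj_eq val_inj) -(next_map val_inj Us) Ds /induced.
have:= valP x; have:= valP y; rewrite !inE.
by case/orP=> [/orP[]|] /eqP-> /orP[/orP[]|] /eqP-> /=;
  rewrite ?(eqxx, ab, bc, ca, ba, cb, ac) ?e_irr ?eab ?ebc ?eca
          ?(e_asym _ _ eab) ?(e_asym _ _ ebc) ?(e_asym _ _ eca).
Qed.

Lemma tricycle_inducedP (T : finType) (e : rel T) (X : {set T}) :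
    is_tricycle (induced e X) ->
  exists a b c, [/\ X = [set a; b; c], uniq [:: a; b; c], e a b, e b c & e c a].
Proof.
case=> s [Us]; case: s Us => [|a [|b [|c []]]] //= Us _ mem_s e_s.
exists (val a), (val b), (val c).
have Uv: uniq (map val [:: a; b; c]) by rewrite (map_inj_uniq val_inj).
have := e_s a b; have := e_s b c; have := e_s c a.
move: Us; rewrite !inE !negb_or !andbT => /andP[/andP[/negPf ab /negPf ac] /negPf bc].
rewrite /= !eqxx !(eq_sym b a, eq_sym c a, eq_sym c b) ab ac bc !eqxx /induced.
move=> -> -> ->; split=> //.
apply/setP=> x; rewrite !inE; apply/idP/idP=> [Xx|].
  by have:= mem_s (Sub x Xx); rewrite !inE -!(inj_eq val_inj) SubK orbA.
by case/orP=> [/orP[]|] /eqP->; apply: valP.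
Qed.

(** * Edge counts and sparseness of buildable sets *)

Section Buildable.
Variables (T : finType) (e : rel T).
Hypotheses (e_irrefl : irreflexive e) (e_3cyclic : three_cyclic e).
Implicit Types (X Y : {set T}) (v x y : T).

Definition num_edges_in X := \sum_(x in X) \sum_(y in X) (e x y : nat).

Lemma num_edges_inT : num_edges_in setT = num_edges e.
Proof.
rewrite /num_edges_in pair_big_dep /= /num_edges -sum1_card [RHS]big_mkcond /=.
rewrite big_mkcond /=.
by apply: eq_bigr => [[x y]] _; rewrite !inE /=; case: (e x y).
Qed.

Lemma sum_edges X (f : pred T) : \sum_(y in X) (f y : nat) = #|[set y in X | f y]|.
Proof.
rewrite -sum1_card big_mkcond [RHS]big_mkcond; apply: eq_bigr => y _.
by rewrite inE; case: (y \in X); case: (f y).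
Qed.

Lemma num_edges_inU1 v X :
    v \notin X ->
  num_edges_in (v |: X) =
    #|[set y in X | e v y]| + #|[set y in X | e y v]| + num_edges_in X.
Proof.
move=> nXv; rewrite /num_edges_in !big_setU1 // e_irrefl /= add0n.
rewrite sum_edges -addnA -(sum_edges X (fun y => e y v)) -big_split /=.
by congr (_ + _); apply: eq_bigr => x _; rewrite big_setU1.
Qed.

Lemma cards3 (a b c : T) : uniq [:: a; b; c] -> #|[set a; b; c]| = 3.
Proof.
move/card_uniqP => /= <-; apply: eq_card => x.
by rewrite !inE orbA.
Qed.

Lemma card_tricycle X : is_tricycle (induced e X) -> #|X| = 3.
Proof. by case/tricycle_inducedP=> a [b [c [-> Uabc _ _ _]]]; apply: cards3. Qed.

Lemma num_edges_tricycle X : is_tricycle (induced e X) -> num_edges_in X = 3.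
Proof.
case/tricycle_inducedP=> a [b [c [-> Uabc eab ebc eca]]].
have asym := edge_asym e_irrefl e_3cyclic.
move: Uabc; rewrite /= !inE !andbT => /andP[/norP[/negPf nab /negPf nac] /negPf nbc].
rewrite /num_edges_in.
have -> : [set a; b; c] = a |: (b |: [set c]) by apply/setP=> x; rewrite !inE orbA.
have sum3 (F : T -> nat) : \sum_(x in a |: (b |: [set c])) F x = F a + (F b + F c).
  by rewrite !big_setU1 ?big_set1 //= !inE ?nab ?nac ?nbc.
rewrite !sum3 !e_irrefl eab ebc eca.
by rewrite (asym _ _ eab) (asym _ _ ebc) (asym _ _ eca).
Qed.

Lemma buildable_num_edges X :
  buildable e X -> 3 <= #|X| /\ num_edges_in X + 3 = 2 * #|X|.
Proof.
elim=> {}X => [/[dup] /card_tricycle-> /num_edges_tricycle-> //|v _ [X3 DX] nXv o1 i1].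
by rewrite num_edges_inU1 // cardsU1 nXv o1 i1; lia.
Qed.

(* The vertex of Y that is added last has at most two neighbours in Y. *)
Lemma buildable_sparse X Y :
    buildable e X -> Y \subset X ->
    (forall x, x \in Y -> 2 < #|[set y in Y | underlying e x y]|) ->
  Y = set0.
Proof.
move=> bX + Ydeg; elim: bX => {}X => [/card_tricycle X3|v bX IHX nXv o1 i1] sYX.
  apply/eqP/set0Pn=> [[x Yx]]; have := Ydeg x Yx.
  rewrite ltnNge => /negP; apply; rewrite -ltnS -X3 (cardsD1 x X).
  rewrite (subsetP sYX) // ltnS; apply/subset_leq_card/subsetP=> y.
  rewrite !inE underlyingE // => /andP[Yy uxy]; rewrite (subsetP sYX) // andbT.
  by apply: contraTneq uxy => ->; rewrite e_irrefl.
have [Yv | nYv] := boolP (v \in Y); last first.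
  apply: IHX; apply/subsetP=> x Yx; have := subsetP sYX x Yx; rewrite !inE.
  by case/predU1P=> // Dx; rewrite -Dx Yx in nYv.
have := Ydeg v Yv; rewrite ltnNge => /negP[].
rewrite -[2]/(1 + 1) -{1}o1 -i1 -cardsUI.
apply: leq_trans (leq_addr _ _); apply/subset_leq_card/subsetP=> y.
rewrite !inE underlyingE // => /andP[Yy uvy].
have := subsetP sYX y Yy; rewrite !inE => /predU1P[Dy|->] //.
by rewrite Dy e_irrefl in uvy.
Qed.

End Buildable.

(** * Growing the whole vertex set from a tricycle *)

Section Growth.
Variables (T : finType) (e : rel T).
Hypotheses (e_irrefl : irreflexive e) (e_3cyclic : three_cyclic e).
Hypotheses (e_unbreakable : unbreakable e).

(** Packages the growth as an induction principle; that no vertex of [X] is isolated, as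
    [growth_step] requires, is maintained inside the proof. *)
Lemma growth_ind (P : {set T} -> Prop) :
    (forall X, is_tricycle (induced e X) -> P X) ->
    (forall X v a b, P X -> v \notin X -> a \in X -> b \in X ->
       e a v -> e v b -> P (v |: X)) ->
  P [set: T].
Proof.
case: e_unbreakable => [[T_gt0 e_conn] [T_ge3 _ u_nocut]] P3 PS.
have [col col_e] := colouring_exists e_3cyclic e_conn T_gt0.
suff grow n : 3 <= n <= #|T| -> exists X : {set T}, [/\ #|X| = n, P X &
    forall x, x \in X -> exists2 y : T, y \in X & underlying e x y].
  have [|X [X_T PX _]] := grow #|T|; first by rewrite T_ge3 leqnn.
  by have <- : X = setT by apply/eqP; rewrite eqEcard subsetT cardsT X_T /=.
elim: n => // n IHn /andP[+ lt_n_T]; rewrite leq_eqVlt => /predU1P[[<-] | n_ge3].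
  have [x [y nxy]] : exists x y : T, x != y.
    have /card_gt1P[x [y [_ _ nxy]]] : 1 < #|T| by apply: leq_trans T_ge3.
    by exists x, y.
  have [z [w [ezw _ _]]] : exists z w : T, [/\ e z w, z \in [set x] & w \notin [set x]].
    by apply: connect_crossing (e_conn x y) _ _; rewrite !inE // eq_sym.
  have [t ewt etz] := edge_triangle e_3cyclic e_conn ezw.
  have tX : is_tricycle (induced e [set z; w; t]).
    by apply: (@is_tricycle_induced _ _ _ z w t) => //; apply: edge_asym.
  exists [set z; w; t]; split; [exact: card_tricycle tX | exact: P3 |].
  have [uzw uwt utz] : [/\ underlying e z w, underlying e w t & underlying e t z].
    by split; apply: edge_underlying.
  move=> a; rewrite !inE => /orP[/orP[]|] /eqP->; [exists w|exists t|exists z];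
    by rewrite ?inE ?eqxx ?orbT.
have [|X [Xn PX Xnbr]] := IHn; first by rewrite -ltnS n_ge3 ltnW.
have /card_gt0P[x0 Xx0] : 0 < #|X| by rewrite Xn; lia.
have nXT : X != setT by apply/eqP=> DX; move: Xn lt_n_T; rewrite DX cardsT; lia.
have [v [a [b [nXv Xa Xb eav evb]]]] :=
  growth_step e_irrefl e_3cyclic e_conn col_e u_nocut Xx0 Xnbr nXT.
exists (v |: X); split; first by rewrite cardsU1 nXv Xn.
  exact: PS eav evb.
move=> x /setU1P[-> | /Xnbr[y Xy uxy]]; last by exists y; rewrite // inE Xy orbT.
by exists b; [rewrite inE Xb orbT | apply: edge_underlying].
Qed.

Lemma num_edges_buildable :
  num_edges e = 2 * #|T| - 3 -> buildable e [set: T].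
Proof.
rewrite -(num_edges_inT e) -cardsT => nT.
(* The inequality is carried along so that equality at the end forces equality at every stage, hence
   one out- and one in-neighbour per added vertex. *)
suff: [/\ 3 <= #|[set: T]|, 2 * #|[set: T]| <= num_edges_in e [set: T] + 3
  & num_edges_in e [set: T] + 3 = 2 * #|[set: T]| -> buildable e [set: T]].
  by case=> T3 _; apply; rewrite nT; lia.
apply: (growth_ind (P := fun X => [/\ 3 <= #|X|, 2 * #|X| <= num_edges_in e X + 3
  & num_edges_in e X + 3 = 2 * #|X| -> buildable e X])) => [X tX | X v a b].
  rewrite (card_tricycle tX) (num_edges_tricycle e_irrefl e_3cyclic tX).
  by split=> // _; apply: Buildable_tricycle.
move=> [X3 leX bX] nXv Xa Xb eav evb; rewrite num_edges_inU1 // cardsU1 nXv.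
have o1 : 0 < #|[set y in X | e v y]| by apply/card_gt0P; exists b; rewrite !inE Xb.
have i1 : 0 < #|[set y in X | e y v]| by apply/card_gt0P; exists a; rewrite !inE Xa.
by split=> [||DX]; [lia..|apply: Buildable_add => //; [apply: bX|..]; lia].
Qed.

End Growth.

(** * Colourings from 3-rings; cycles and wheels as lists *)

Lemma three_ring_colouring (T : finType) (e : rel T) (A : 'I_3 -> {set T}) :
    three_ring e A ->
  exists col : T -> 'I_3, (forall x y, e x y -> col y = ordS (col x)) /\
    forall i, A i :|: A (ordS i) = away col (ordS (ordS i)).
Proof.
(* The default [ord0] is never taken, since [part] puts each vertex in a class. *)
case=> part edge; pose col x := odflt ord0 [pick i | x \in A i].
have memA x i : (x \in A i) = (col x == i).
  have [j [Aj uniqj]] := part x; rewrite /col; case: pickP => [k Ak | /(_ j)];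
    last by rewrite Aj.
  by rewrite -(uniqj k Ak); apply/idP/eqP=> [/uniqj | <-].
exists col; split=> [x y /edge[i []] | i].
  by rewrite !memA => /eqP-> /eqP->.
apply/setP=> x; rewrite mem_away inE !memA.
exact: ord3_avoid.
Qed.

Lemma tree_acyclic (T : finType) (r : rel T) (S : {set T}) (c : seq T) :
    is_tree (induced r S) -> {subset c <= S} -> 2 < size c -> uniq c ->
  ~~ cycle r c.
Proof.
case=> _ acyc /map_val_lift[s <-]; rewrite size_map (map_inj_uniq val_inj) => s3 Us.
by rewrite cycle_map; apply: acyc.
Qed.

(** The value of [f] flips at each step and must be restored after one full turn. *)
Lemma even_cycle (T : eqType) (r : rel T) (f : pred T) (c : seq T) :
    {in c &, forall x y, r x y -> f y = ~~ f x} -> cycle r c -> ~~ odd (size c).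
Proof.
case: c => // x c fN rc.
have fP (p : seq T) y : {subset y :: p <= x :: c} -> path r y p ->
    f (last y p) = f y (+) odd (size p).
  elim: p y => [|z p IHp] y sub /=; first by rewrite addbF.
  case/andP=> ryz rp; rewrite (IHp z) // => [|t pt]; last by rewrite sub // inE pt orbT.
  rewrite (fN y z) ?sub ?mem_head ?inE ?eqxx ?orbT //.
  by case: (f y); case: (odd _).
have sub: {subset x :: rcons c x <= x :: c}.
  by move=> y; rewrite inE mem_rcons inE orbA orbb.
have := fP _ _ sub rc; rewrite last_rcons size_rcons /=.
by case: (f x); case: (odd _).
Qed.

Lemma wheel_adj_map (T T' : finType) (h : T -> T') v (c : seq T) x y :
    injective h -> uniq c ->
  wheel_adj (h v) (map h c) (h x) (h y) = wheel_adj v c x y.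
Proof.
move=> hI Uc.
by rewrite /wheel_adj /cycle_adj !(mem_map hI) !next_map // !(inj_eq hI).
Qed.

Lemma wheel_adj_sym (T : finType) v (c : seq T) : symmetric (wheel_adj v c).
Proof.
by move=> x y; rewrite /wheel_adj /cycle_adj; congr (_ || _); apply: orbC.
Qed.

Lemma next_neq_prev (T : eqType) (c : seq T) x :
  uniq c -> x \in c -> 2 < size c -> next c x != prev c x.
Proof.
move=> Uc /rot_to[i s Ds]; rewrite -(next_rot i Uc) -(prev_rot i Uc) -(size_rot i).
move: Uc; rewrite -(rot_uniq i) Ds; case: s {Ds} => [|y [|z s]] // Uc _.
have /and3P[nx ny _] := Uc.
rewrite prev_nth mem_head (memNindex nx) /= eqxx (nth_last x (z :: s)) /=.
by apply: contraNneq ny => ->; apply: mem_last.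
Qed.

(** * Diwheels and the tree condition *)

Section Diwheels.
Variables (T : finType) (e : rel T).
Hypotheses (e_irrefl : irreflexive e) (e_3cyclic : three_cyclic e).

(** A rim vertex sees the hub and its two rim neighbours; the hub sees the whole rim. *)
Lemma diwheel_degree (X : {set T}) (F : rel T) (x : T) :
    subrel F e -> is_diwheel (induced F X) -> x \in X ->
  2 < #|[set y in X | underlying e x y]|.
Proof.
move=> sFe [v [c [[/andP[nvc Uc] memc] [c4 _] [orient _] _]]] Xx.
pose x' : {x | x \in X} := Sub x Xx.
suff [s Us [s3 adj]] : exists2 s, uniq s &
    2 < size s /\ {in s, forall y, wheel_adj v c x' y}.
  have Um: uniq (map val s) by rewrite (map_inj_uniq val_inj).
  apply: leq_trans s3 _; rewrite -(size_map val) -(card_uniqP Um).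
  apply/subset_leq_card/subsetP=> _ /mapP[y /adj adj_y ->].
  rewrite inE (valP y) underlyingE // -[x]/(val x').
  by move: adj_y; rewrite orient => /orP[] /sFe ->; rewrite ?orbT.
have [cx | ncx] := boolP (x' \in c).
  exists [:: v; next c x'; prev c x'].
    rewrite /= !inE negb_or (next_neq_prev Uc cx (ltnW c4)) !andbT.
    by rewrite !(contraNneq _ nvc) // => ->; rewrite ?mem_next ?mem_prev.
  split=> // y; rewrite !inE /wheel_adj /cycle_adj.
  case/or3P=> /eqP->; rewrite ?eqxx ?mem_next ?mem_prev ?cx ?orbT //.
  by rewrite next_prev // eqxx orbT.
have /eqP Dx: x' == v by have:= memc x'; rewrite inE (negPf ncx) orbF.
exists c => //; split=> [|y cy]; first exact: ltnW.
by rewrite /wheel_adj Dx eqxx cy orbT.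
Qed.

Lemma buildable_diwheel_free : buildable e setT -> diwheel_free e.
Proof.
move=> bT X F sFe dX; have [v [c [[_ _] _ _ _]]] := dX.
have X0 : X = set0.
  apply: (buildable_sparse e_irrefl bT (subsetT X)) => x.
  exact: diwheel_degree sFe dX.
by move: (val v) (valP v) => x; rewrite X0 inE.
Qed.

Variable col : T -> 'I_3.
Hypothesis col_e : forall x y, e x y -> col y = ordS (col x).

Lemma cycle_diwheel (e_conn : forall x y, connect e x y) i (c : seq T) :
    {subset c <= away col i} -> 2 < size c -> uniq c -> cycle (underlying e) c ->
  ~ diwheel_free e.
Proof.
move=> ic c3 Uc uc.
have asym := edge_asym e_irrefl e_3cyclic.
(* The hub completes a tricycle on the first edge of [c]; the ends of that edge use up the colours
   other than [i]. The rest of [c] is a path between these ends, so [hub_path] applies. *)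
have [v [cv uvc]] : exists v, col v = i /\ all (underlying e v) c.
  case: c ic c3 Uc uc => [|x [|y c]] // ic _ Uc uc.
  have uxy : underlying e x y by case/andP: uc.
  have [v [uvx uvy]] : exists v, underlying e v x /\ underlying e v y.
    move: uxy; rewrite underlyingE // => /orP[] exy;
      have [v eyv evx] := edge_triangle e_3cyclic e_conn exy; exists v;
      by rewrite (edge_underlying e_irrefl evx) (edge_underlyingC e_irrefl eyv).
  have cv : col v = i.
    have [ix iy] : x \in away col i /\ y \in away col i by rewrite !ic ?inE ?eqxx ?orbT.
    have := col_u e_irrefl col_e uvx; have := col_u e_irrefl col_e uvy.
    have := col_u e_irrefl col_e uxy; move: ix iy; rewrite !mem_away.
    by move: (col x) (col y) (col v) i {ic} => [[|[|[|?]]] ?] [[|[|[|?]]] ?]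
       [[|[|[|?]]] ?] [[|[|[|?]]] ?] // *; apply: val_inj.
  exists v; split=> //.
  have Ur : uniq (y :: rcons c x) by rewrite -rcons_cons -rot1_cons rot_uniq.
  have : all (underlying e v) (rcons c x).
    apply: (hub_path e_irrefl e_3cyclic e_conn col_e) Ur uvy _; last by rewrite last_rcons.
    rewrite cv; apply: sub_path_restr; first by rewrite ic ?inE ?eqxx ?orbT.
      by move=> z; rewrite mem_rcons => cz; apply: ic; move: cz;
         rewrite !inE => /orP[->|->]; rewrite ?orbT.
    by case/andP: uc.
  by rewrite all_rcons /= => /andP[-> ->]; rewrite uvy.
have nvc : v \notin c by apply/negP=> /ic; rewrite mem_away cv eqxx.
(* Only two colours occur away from [i], and they alternate along [c]. *)
have evenc : ~~ odd (size c).
  apply: (@even_cycle _ _ (fun x => col x == ordS i)) uc => x y /ic ix /ic iy.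
  move/(col_u e_irrefl col_e); move: ix iy; rewrite !mem_away.
  by move: (col x) (col y) i {ic cv} => [[|[|[|?]]] ?] [[|[|[|?]]] ?] [[|[|[|?]]] ?].
have uwheel x y : wheel_adj v c x y -> underlying e x y.
  rewrite /wheel_adj /cycle_adj => /or3P[/orP[]|/andP[/eqP-> cy]|/andP[/eqP-> cx]].
  - by case/andP=> cx /eqP->; apply: next_cycle uc cx.
  - by case/andP=> cy /eqP->; rewrite underlying_sym //; apply: next_cycle uc cy.
  - exact: (allP uvc).
  by rewrite underlying_sym //; apply: (allP uvc).
(* [F] discards chords of [c], which a diwheel does not have. *)
pose X := [set x in v :: c]; pose F := [rel x y | e x y && wheel_adj v c x y].
have [|s Ds] := @map_val_lift _ X (v :: c); first by move=> x vcx; rewrite inE.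
case: s Ds => // v' c' [Dv Dc] free.
have Uc' : uniq c' by rewrite -(map_inj_uniq val_inj) Dc.
have wheelE (x y : {x | x \in X}) : wheel_adj v' c' x y = wheel_adj v c (val x) (val y).
  by rewrite -Dv -Dc wheel_adj_map //; apply: val_inj.
have FE (x y : {x | x \in X}) :
  induced F X x y = e (val x) (val y) && wheel_adj v c (val x) (val y) by [].
apply: (free X F) => [x y /andP[] //|].
exists v', c'; split.
- split; first by rewrite -(map_inj_uniq val_inj) /= Dv Dc nvc.
  by move=> x; rewrite -(mem_map val_inj) /= Dv Dc; have:= valP x; rewrite inE.
- rewrite -(size_map val) Dc; split=> //.
  by move: c3 evenc; rewrite leq_eqVlt => /predU1P[<-|].
- split=> x y; last by rewrite !FE; apply/negP=> /andP[/andP[/asym-> _] /andP[]].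
  rewrite !FE wheelE (wheel_adj_sym _ _ (val y)) -andb_orl -underlyingE //.
  have := @uwheel (val x) (val y).
  by case: wheel_adj => [->|_]; rewrite ?andbT ?andbF.
move=> x y cxy.
have Fasym z t : induced F X z t -> induced F X t z = false.
  by rewrite !FE => /andP[/asym-> _].
have wF z t : wheel_adj v' c' z t -> e (val z) (val t) -> induced F X z t.
  by rewrite FE wheelE => -> ->.
have [cx cy] : x \in c' /\ y \in c'.
  by case/orP: cxy => /andP[cz /eqP->]; rewrite mem_next cz.
have wxy : wheel_adj v' c' x y by rewrite /wheel_adj cxy.
have wyv : wheel_adj v' c' y v' by rewrite /wheel_adj eqxx cy !orbT.
have wxv : wheel_adj v' c' x v' by rewrite /wheel_adj eqxx cx !orbT.
have uw z t : wheel_adj v' c' z t -> underlying e (val z) (val t).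
  by rewrite wheelE; apply: uwheel.
(* Colours advance by one along each edge, so an edge from [z] to [t] forces the spokes to go from
   [t] to the hub and from the hub to [z]. *)
have orient z t : wheel_adj v' c' z t -> wheel_adj v' c' t v' ->
    wheel_adj v' c' z v' -> e (val z) (val t) ->
  is_tricycle (induced (induced F X) [set z; t; v']).
  move=> wzt wtv wzv ezt; have [ctz uzv utv] := And3 (col_e ezt) (uw _ _ wzv) (uw _ _ wtv).
  have etv : e (val t) (val v').
    move: utv; rewrite underlyingE // => /orP[//|/col_e].
    by rewrite ctz => /ordS_inj Dz; have := col_u e_irrefl col_e uzv; rewrite Dz eqxx.
  have evz : e (val v') (val z).
    move: uzv; rewrite underlyingE // => /orP[/col_e|//].
    by rewrite (col_e etv) ctz => /ordS_inj/eqP; rewrite ordS_neq.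
  by apply: (is_tricycle_induced Fasym) => //; apply: wF; rewrite // wheel_adj_sym.
have := uw _ _ wxy; rewrite underlyingE // => /orP[] exy; first exact: orient.
by rewrite (setUC [set x]); apply: orient => //; rewrite wheel_adj_sym.
Qed.
Lemma diwheel_free_trees :
    unbreakable e -> diwheel_free e ->
  forall i, is_tree (induced (underlying e) (away col i)).
Proof.
case=> [[T_gt0 e_conn] [T_ge3 _ u_nocut]] free i; split; last first.
  move=> s s3 Us; apply/negP=> us.
  apply: (@cycle_diwheel e_conn i (map val s)) free;
    rewrite ?size_map ?(map_inj_uniq val_inj) //.
    by move=> _ /mapP[x _ ->]; apply: valP.
  by rewrite cycle_map.
split; last first.
  move=> x y; rewrite connect_inducedE.
  exact: (away_connected e_irrefl e_3cyclic e_conn col_e u_nocut (valP x) (valP y)).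
(* Non-nullness: a vertex coloured [i] has an out-neighbour, which is not coloured [i]. *)
have /card_gt0P[x _] := T_gt0.
have [ix | ] := boolP (x \in away col i); first by apply/card_gt0P; exists (Sub x ix).
rewrite mem_away negbK => /eqP cx.
have [y nxy] : exists y, y \notin [set x].
  have /card_gt1P[y [z [_ _ nyz]]] : 1 < #|T| by apply: leq_trans T_ge3.
  have [Dy | nyx] := eqVneq y x; last by exists y; rewrite inE.
  by exists z; rewrite inE eq_sym -Dy.
have [z [w [ezw /set1P Dz _]]] := connect_crossing (e_conn x y) (set11 x) nxy.
have iw : w \in away col i by rewrite mem_away (col_e ezw) Dz cx ordS_neq.
by apply/card_gt0P; exists (Sub w iw).
Qed.

(** A vertex has at most one neighbour in a connected part of a tree not containing it; so
    connectedness of [X] away from each colour is maintained along with buildability. *)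
Lemma trees_buildable :
    unbreakable e ->
    (forall i, is_tree (induced (underlying e) (away col i))) ->
  buildable e setT.
Proof.
move=> e_unb trees; pose u := underlying e.
have usym (S : {set T}) := sym_connect_sym (restr_sym S (underlying_sym e_irrefl)).
pose connected X := forall i x y, x \in X :&: away col i -> y \in X :&: away col i ->
  connect (restr u (X :&: away col i)) x y.
suff [] : buildable e [set: T] /\ connected [set: T] by [].
apply: (growth_ind e_irrefl e_3cyclic e_unb
  (P := fun X => buildable e X /\ connected X)) => //.
  move=> X tX; split; first exact: Buildable_tricycle.
  case/tricycle_inducedP: tX => a [b [c [-> _ eab ebc eca]]] i x y Xx Xy.
  have [-> | nxy] := eqVneq x y; first exact: connect0.
  apply: connect1; rewrite /restr /= Xx Xy.
  move: Xx Xy nxy; rewrite !inE /u underlyingE // => /andP[+ _] /andP[+ _].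
  by case/orP=> [/orP[]|] /eqP-> /orP[/orP[]|] /eqP->;
    rewrite ?eqxx ?eab ?ebc ?eca ?orbT.
move=> X v a b [bX cX] nXv Xa Xb eav evb.
have uniq_nbr i x y : v \in away col i -> x \in X :&: away col i ->
    y \in X :&: away col i -> u v x -> u v y -> x = y.
  move=> iv Xx Xy uvx uvy; have [// | nxy] := eqVneq x y.
  have [p [rp Dy Up]] := connect_uniq_path (cX i x y Xx Xy).
  have [up sp] := path_restrP Xx rp.
  have sxp z : z \in x :: p -> z \in X :&: away col i by case/predU1P=> [->|/sp].
  have/negP[] : ~~ cycle u (v :: x :: p).
    apply: tree_acyclic (trees i) _ _ _.
    - by move=> z /predU1P[-> //|/sxp]; rewrite inE => /andP[].
    - by case: p Dy {rp Up up sp sxp} => //= Dx; rewrite Dx eqxx in nxy.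
    rewrite cons_uniq Up andbT; apply: contra nXv => /sxp.
    by rewrite inE => /andP[].
  by rewrite /= rcons_path up Dy uvx /u underlying_sym.
split.
  apply: Buildable_add => //; apply/eqP/cards1P; [exists b | exists a].
    apply/setP=> x; rewrite !inE; apply/andP/eqP=> [[Xx evx] | ->] //.
    (* [v] and its out-neighbours use two colours and avoid this third one; for in-neighbours the
       avoided colour is [ordS (col v)]. *)
    apply: (uniq_nbr (ordS (ordS (col v))));
      rewrite /u ?inE ?Xx ?Xb ?underlyingE ?evx ?evb //=.
    - by rewrite eq_sym ordSS_neq.
    - by rewrite (col_e evx) eq_sym ordS_neq.
    by rewrite (col_e evb) eq_sym ordS_neq.
  apply/setP=> x; rewrite !inE; apply/andP/eqP=> [[Xx exv] | ->] //.
  have cax : col a = col x by apply: ordS_inj; rewrite -(col_e eav) -(col_e exv).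
  apply: (uniq_nbr (ordS (col v)));
    rewrite /u ?inE ?Xx ?Xa ?underlyingE ?exv ?eav ?orbT //=.
  - by rewrite eq_sym ordS_neq.
  - by rewrite (col_e exv) eq_sym ordSS_neq.
  by rewrite (col_e exv) cax eq_sym ordSS_neq.
move=> i; have sXvX : X :&: away col i \subset (v |: X) :&: away col i.
  by apply: setSI; apply: subsetUr.
have [cv | iv] := eqVneq (col v) i.
  suff -> : (v |: X) :&: away col i = X :&: away col i by apply: cX.
  by apply/setP=> x; rewrite !inE; case: eqVneq => // ->; rewrite cv eqxx !andbF.
(* [a] and [b] differ in colour, so one of them is not coloured [i] and attaches [v] to the old
   part. *)
have [w [Xw uvw]] : exists w, w \in X :&: away col i /\ u v w.
  have [ca | ia] := eqVneq (col a) i.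
    exists b; rewrite !inE Xb (col_e evb) (col_e eav) ca ordSS_neq.
    by rewrite /u edge_underlying.
  by exists a; rewrite !inE Xa ia /u edge_underlyingC.
suff cw x : x \in (v |: X) :&: away col i ->
    connect (restr u ((v |: X) :&: away col i)) x w.
  by move=> x y /cw xw /cw; rewrite usym; apply: connect_trans.
rewrite inE => /andP[/setU1P[->|Xx] ix].
  apply: connect1; rewrite /restr /= uvw (subsetP sXvX w Xw).
  by rewrite !inE eqxx iv.
by apply: connect_restrS sXvX _; apply: cX; rewrite // inE Xx.
Qed.

End Diwheels.

Theorem mainTheorem2 (T : finType) (e : rel T)
    (e_irrefl : irreflexive e)
    (e_3cyclic : three_cyclic e)
    (e_unbreakable : unbreakable e) :
  [<-> diwheel_free e;
       exists A : 'I_3 -> {set T},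
         three_ring e A /\
         forall i : 'I_3,
           is_tree (induced (underlying e) (A i :|: A (ordS i)));
       buildable e [set: T];
       num_edges e = 2 * #|T| - 3].
Proof.
tfae.
- move=> free; have [[T_gt0 e_conn] _] := e_unbreakable.
  have [col col_e] := colouring_exists e_3cyclic e_conn T_gt0.
  exists (fun i => [set x | col x == i]); split; [split|] => [x|x y exy|i].
  + by exists (col x); split=> [|j]; rewrite inE // => /eqP.
  + by exists (col x); rewrite !inE (col_e x y exy).
  suff -> : [set x | col x == i] :|: [set x | col x == ordS i]
      = away col (ordS (ordS i)).
    exact: diwheel_free_trees.
  by apply/setP=> x; rewrite mem_away !inE ord3_avoid.
- case=> A [/three_ring_colouring[col [col_e colA]] trees].
  apply: (trees_buildable e_irrefl e_3cyclic col_e) => // i.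
  (* The vertices away from [i] form the classes [ordS i] and [ordS (ordS i)]. *)
  by rewrite -(ordS3 i) -colA.
- case/(buildable_num_edges e_irrefl e_3cyclic) => _.
  by rewrite num_edges_inT cardsT => <-; rewrite addnK.
by move/(num_edges_buildable e_irrefl e_3cyclic e_unbreakable)/buildable_diwheel_free; apply.
Qed.
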